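(* Suppose that the group $G$ satisfies the following two conditions: (1) every infinite cyclic subgroup $C\subseteq G$ has finite index $[C_GC:C]$ in its centralizer $C_GC$; (2) every ascending chain $H_1\subseteq H_2\subseteq\cdots$ of finite subgroups of $G$ becomes stationary, i.e. there is $n_0\in\mathbb{N}$ such that $H_n=H_{n_0}$ for all $n\ge n_0$. Then every infinite virtually cyclic subgroup $V\subseteq G$ is contained in a unique maximal virtually cyclic subgroup $V_{\max}\subseteq G$. Moreover, $V_{\max}$ is equal to its normalizer $N_G(V_{\max})$, and $$V_{\max}=\bigcup_{C\subseteq V}N_GC,$$ where the union is over all infinite cyclic subgroups $C\subseteq V$ that are normal in $V$. In particular, $G$ satisfies $(N\!M_{\mathcal{FIN}\subseteq\mathcal{VCY}})$.
   Context: $C_GC$ and $N_GC$ denote the centralizer and normalizer of $C$ in $G$. $\mathcal{FIN}$ and $\mathcal{VCY}$ are the families of finite and of virtually cyclic subgroups of $G$. $G$ satisfies $(N\!M_{\mathcal{FIN}\subseteq\mathcal{VCY}})$ if every infinite virtually cyclic subgroup of $G$ is contained in a unique infinite virtually cyclic subgroup that is maximal (under inclusion) among infinite virtually cyclic subgroups of $G$, and every such maximal subgroup $M$ satisfies $N_GM=M$. *)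

(* Defs.v *)
From mathcomp Require Import all_boot.
From mathcomp Require Import boolp classical_sets cardinality.

Set Implicit Arguments.
Unset Strict Implicit.
Unset Printing Implicit Defensive.

Local Open Scope classical_set_scope.
Local Open Scope group_scope.

(* [groupType] is MathComp's structure of possibly infinite groups. Its
   subgroups are represented by their underlying sets, so that equality and
   inclusion of subgroups are equality and inclusion of sets. *)

Section Subgroups.
Variable G : groupType.
Implicit Types (x y : G) (C H K M V : set G).

Definition is_subgroup H : Prop := group_closed [in H].

(* All the powers x^n with n an integer, the negative ones being x ^- n. *)
Definition cycle x : set G :=
  [set y | exists n : nat, y = x ^+ n \/ y = x ^- n].

Definition cyclic C : Prop := exists x, C = cycle x.

Definition infinite_cyclic C : Prop := cyclic C /\ infinite_set C.

Definition lcoset x H : set G := [set x * y | y in H].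

(* [H : K] is finite, for a subgroup K of H. *)
Definition finite_index H K : Prop := finite_set [set lcoset x K | x in H].

Definition centralizer H : set G := [set x | forall y, H y -> commute x y].

(* An equality of sets is required: when H is infinite, the inclusion of a
   conjugate of H in H does not suffice. *)
Definition normalizer H : set G := [set x | [set y ^ x | y in H] = H].

Definition normal_in H K : Prop := H `<=` K /\ K `<=` normalizer H.

(* Finite subgroups are virtually cyclic: C may be the trivial group. *)
Definition virtually_cyclic V : Prop :=
  is_subgroup V /\ exists C, [/\ cyclic C, C `<=` V & finite_index V C].

Definition infinite_virtually_cyclic V : Prop :=
  virtually_cyclic V /\ infinite_set V.

Definition maximal_among (P : set G -> Prop) M : Prop :=
  P M /\ forall K, P K -> M `<=` K -> K = M.

End Subgroups.

Arguments cyclic {G} C.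
Arguments infinite_cyclic {G} C.
Arguments virtually_cyclic {G} V.
Arguments infinite_virtually_cyclic {G} V.

Definition NM_FIN_VCY (G : groupType) : Prop :=
  (forall V : set G, infinite_virtually_cyclic V ->
     exists! M : set G, maximal_among infinite_virtually_cyclic M /\ V `<=` M)
  /\
  (forall M : set G, maximal_among infinite_virtually_cyclic M ->
     normalizer M = M).

(* Main.v *)
Require Import Defs.
From mathcomp Require Import all_boot.
From mathcomp Require Import ssralg ssrnum ssrint intdiv zify.
From mathcomp Require Import boolp classical_sets cardinality.

Import GRing.Theory Num.Theory.

Local Open Scope classical_set_scope.
Local Open Scope group_scope.

(** Let [V] be infinite virtually cyclic and let [c] in [V] have infinite order.
    The maximal virtually cyclic subgroup containing [V] is the commensurator
    [E] of [c], the subgroup of those [g] for which [c] and [c ^ g] have a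
    common power with nonzero exponents.  Any two elements of infinite order of
    a virtually cyclic group have such a common power, so every virtually
    cyclic group that contains [c] lies in [E] ([sub_commensurator_of_vc]).
    Hence almost everything follows once [E] is virtually cyclic: it is
    then the largest virtually cyclic subgroup containing [c]; an element that
    normalizes [E] sends [c] to another element of infinite order of [E],
    hence lies in [E]; and an element that normalizes an infinite cyclic
    subgroup of [V] sends a generator of it, which is commensurable with [c],
    to a power of that generator, hence lies in [E].

    To see that [E] is virtually cyclic, consider first the subgroup [Z] of
    the elements that commute with some power [c ^+ m], [m > 0].  It is the
    union of the centralizers of [c ^+ m], each of which contains the central
    infinite cyclic group of [c ^+ m] with finite index by the first hypothesis.
    The transfer to that central subgroup ([transfer]) is a homomorphism to the
    integers whose kernel is the set of torsion elements; so these form a finite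
    subgroup.  Along the factorials the centralizers increase, and the chain
    condition makes their torsion subgroups stationary: [Z] has only finitely
    many torsion elements ([finite_torsion_virtual_centralizer]).  The transfer
    also kills the commutators of [c] with elements of [Z], so the conjugates
    of [c] under [Z] are products of [c] with these finitely many elements.
    Therefore the centralizer of [c], and with it the group of [c], has finite
    index in [Z], and [Z] is the centralizer of a single power of [c].

    Finally [Z] has index at most two in [E], because a relation
    [(c ^^ m) ^ g = c ^^ n] forces [n = m] or [n = - m]: conjugation by [g]
    maps [Z] onto itself, so it multiplies the transfer by a rational number
    that preserves its image ([conj_exponents]).  Since finitely many cosets
    of the group of [c] cover [E], one exponent [M] works for all of [E],
    and [E] normalizes the infinite cyclic group of [c ^+ M]; this gives the
    other inclusion of the formula for [E] as a union of normalizers. *)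

(** * Integer powers and subgroups *)

Definition zpow {G : groupType} (x : G) (k : int) : G :=
  match k with Posz n => x ^+ n | Negz n => x ^- n.+1 end.

Local Notation "x ^^ k" := (zpow x k) (at level 29, left associativity).

Section IntegerPowers.
Context {G : groupType}.
Implicit Types (x y g : G) (j k : int).

Lemma zpowN x k : x ^^ (- k)%R = (x ^^ k)^-1.
Proof.
case: k => [[|n]|n] /=; first by rewrite invg1.
- by [].
- by rewrite invgK.
Qed.

Lemma zpowS x k : x ^^ (k + 1)%R = x ^^ k * x.
Proof.
elim/int_ind: k => [|n _|n _].
- by rewrite /= mul1g.
- by rewrite -PoszD /= addn1 expgSr.
- have -> : (- n.+1%:Z + 1 = - n%:Z)%R by lia.
  by rewrite !zpowN /= expgS invgM mulgVK.
Qed.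

Lemma zpowD x j k : x ^^ (j + k)%R = x ^^ j * x ^^ k.
Proof.
elim/int_ind: k => [|n IH|n IH].
- by rewrite addr0 mulg1.
- have -> : (j + n.+1%:Z = (j + n%:Z) + 1)%R by lia.
  have -> : (n.+1%:Z = n%:Z + 1)%R by lia.
  by rewrite !zpowS IH mulgA.
- apply: (mulIg x); rewrite -zpowS -mulgA -zpowS.
  have -> : (- n.+1%:Z + 1 = - n%:Z)%R by lia.
  by rewrite -IH; congr (_ ^^ _); lia.
Qed.

Lemma zpowM x j k : x ^^ (j * k)%R = x ^^ j ^^ k.
Proof.
elim/int_ind: k => [|n IH|n IH]; first by rewrite mulr0.
- have -> : (n.+1%:Z = n%:Z + 1)%R by lia.
  by rewrite zpowS mulrDr mulr1 zpowD IH.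
- have -> : (- n.+1%:Z = - n%:Z - 1)%R by lia.
  by rewrite mulrBr mulr1 !zpowD -IH !zpowN.
Qed.

Lemma zpowC x j k : x ^^ j ^^ k = x ^^ k ^^ j.
Proof. by rewrite -!zpowM mulrC. Qed.

Lemma zpow1g k : 1 ^^ k = 1 :> G.
Proof. by case: k => n; rewrite /= expg1n ?invg1. Qed.

Lemma conjg_zpow x g k : (x ^^ k) ^ g = (x ^ g) ^^ k.
Proof. by case: k => n; rewrite /= ?conjVg conjXg. Qed.

Lemma commute_conjg g x : commute g x <-> x ^ g = x.
Proof.
split=> [e|e]; first by rewrite conjgE -e mulKg.
by rewrite /commute -{1}e conjgE mulVKg.
Qed.

Lemma commute_zpow x g k : commute g x -> commute g (x ^^ k).
Proof. by move/commute_conjg=> e; apply/commute_conjg; rewrite conjg_zpow e. Qed.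

End IntegerPowers.

Section Subgroups.
Context {G : groupType}.
Implicit Types (x y g : G) (A H : set G).

Lemma is_subgroupP H :
  is_subgroup H <-> H 1 /\ forall x y, H x -> H y -> H (x / y).
Proof.
rewrite /is_subgroup /group_closed inE.
split=> -[H1 HB]; split=> // x y.
- by move=> Hx Hy; have:= HB x y; rewrite !inE; apply.
- by rewrite !inE; apply: HB.
Qed.

Lemma subgroup1 {H} : is_subgroup H -> H 1.
Proof. by case/is_subgroupP. Qed.

Lemma subgroupV {H x} : is_subgroup H -> H x -> H x^-1.
Proof. by case/is_subgroupP=> H1 HB Hx; rewrite -div1g; apply: HB. Qed.

Lemma subgroupM {H x y} : is_subgroup H -> H x -> H y -> H (x * y).
Proof.
move=> sH Hx Hy; rewrite -[y]invgK; case/is_subgroupP: (sH) => _; apply=> //.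
exact: subgroupV.
Qed.

Lemma subgroupX {H x k} : is_subgroup H -> H x -> H (x ^^ k).
Proof.
move=> sH Hx; have nat_case n : H (x ^+ n).
  elim: n => [|n IH]; first exact: subgroup1.
  by rewrite expgS; apply: subgroupM.
by case: k => n //=; apply: subgroupV.
Qed.

Lemma subgroupJ {H x y} : is_subgroup H -> H x -> H y -> H (x ^ y).
Proof.
by move=> sH Hx Hy; apply: subgroupM => //; [apply: subgroupV|apply: subgroupM].
Qed.

Lemma cycleE x y : Defs.cycle x y <-> exists k : int, y = x ^^ k.
Proof.
split=> [[n [->|->]]|[[n|n] ->]].
- by exists (Posz n).
- by exists (- n%:Z)%R; rewrite zpowN.
- by exists n; left.
- by exists n.+1; right.
Qed.

Lemma cycle_id x : Defs.cycle x x.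
Proof. by apply/cycleE; exists 1%R. Qed.

Lemma cycle_subgroup x : is_subgroup (Defs.cycle x).
Proof.
apply/is_subgroupP; split; first by apply/cycleE; exists 0%R.
move=> _ _ /cycleE[j ->] /cycleE[k ->]; apply/cycleE; exists (j - k)%R.
by rewrite zpowD zpowN.
Qed.

Lemma cycle_sub {H x} : is_subgroup H -> H x -> Defs.cycle x `<=` H.
Proof. by move=> sH Hx _ /cycleE[k ->]; apply: subgroupX. Qed.

Lemma centralizer_subgroup A : is_subgroup (centralizer A).
Proof.
apply/is_subgroupP; split=> [y _|x y Cx Cy a Aa].
  exact/commute_sym/commute1.
apply/commute_conjg; rewrite conjgM (proj1 (commute_conjg _ _) (Cx a Aa)).
by apply/commute_conjg/commute_sym/commuteV/commute_sym/Cy.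
Qed.

Lemma centralizer_cycle x : centralizer (Defs.cycle x) = [set g | commute g x].
Proof.
apply/seteqP; split=> g /= Cg; first exact/Cg/cycle_id.
by move=> _ /cycleE[k ->]; apply: commute_zpow.
Qed.

Lemma normalizerP H g : is_subgroup H ->
  normalizer H g <-> (forall x, H x <-> H (x ^ g)).
Proof.
move=> sH; split=> [e x|e].
  split=> [Hx|]; first by rewrite -e; exists x.
  by rewrite -{1}e => -[y Hy /conjg_inj <-].
apply/seteqP; split=> [_ [x Hx <-]|x Hx]; first exact: (e x).1.
exists (x ^ g^-1); rewrite ?conjgKV //.
by apply: (e _).2; rewrite conjgKV.
Qed.

Lemma sub_normalizer H : is_subgroup H -> H `<=` normalizer H.
Proof.
move=> sH g Hg; apply/normalizerP => // x; split=> [Hx|Hxg]; first exact: subgroupJ.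
by rewrite -(conjgK g x); apply: subgroupJ => //; apply: subgroupV.
Qed.

End Subgroups.

(** * Covers by finitely many cosets, and elements of infinite order *)

Section FiniteCovers.
Context {G : groupType}.
Implicit Types (x y z g c d : G) (A B C H K : set G).

Definition infinite_order x := forall k : int, x ^^ k = 1 -> k = 0%R.

(** Finiteness of the index, for sets [A] and [B] that need not be subgroups
    nor contained in each other: this makes it monotone in both arguments and
    transitive without side conditions. *)
Definition finite_cover A B :=
  exists s : seq G, forall x, A x -> exists2 r, r \in s & B (r^-1 * x).

(** When [B] is a subgroup, two elements of [A] in the same left coset of a
    representative differ by an element of [B]; so a representative outside
    [A] can be exchanged for any element of [A] in its coset. *)
Lemma finite_cover_reps {A B} : is_subgroup B -> finite_cover A B ->
  exists s : seq G, (forall r, r \in s -> A r) /\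
    forall x, A x -> exists2 r, r \in s & B (r^-1 * x).
Proof.
move=> sB [s sP]; pose D r : set G := [set x | A x /\ B (r^-1 * x)].
exists [seq xget 1 (D r) | r <- s & `[< D r !=set0 >]]; split=> [r|x Ax].
  by case/mapP=> t; rewrite mem_filter => /andP[/asboolP D0 _] ->; case: (xgetPex 1 D0).
have [r rs Brx] := sP x Ax.
have D0 : D r !=set0 by exists x.
exists (xget 1 (D r)); first by apply: map_f; rewrite mem_filter rs andbT; apply/asboolP.
have [_ Br] := xgetPex 1 D0.
have -> : (xget 1 (D r))^-1 * x = (r^-1 * xget 1 (D r))^-1 * (r^-1 * x).
  by rewrite invgM invgK -mulgA mulVKg.
by apply: subgroupM => //; apply: subgroupV.
Qed.

Lemma finite_cover_of_image {T : choiceType} (f : G -> T) {A B} :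
  finite_set [set f x | x in A] ->
  (forall x y, A x -> A y -> f x = f y -> B (x^-1 * y)) -> finite_cover A B.
Proof.
move=> /finite_seqP[s fA] fP; pose D t : set G := [set x | A x /\ f x = t].
exists [seq xget 1 (D t) | t <- s] => x Ax.
have fxs : f x \in s.
  have : [set f x | x in A] (f x) by exists x.
  by rewrite fA.
have [Ar fr] : D (f x) (xget 1 (D (f x))).
  have : D (f x) !=set0 by exists x.
  exact: xgetPex.
by exists (xget 1 (D (f x))); [apply: map_f | apply: fP].
Qed.

Lemma lcoset_eqP {H x y} : is_subgroup H ->
  lcoset x H = lcoset y H <-> H (x^-1 * y).
Proof.
move=> sH; split=> [e|Hxy].
  have : lcoset y H y by exists 1; rewrite ?mulg1 //; apply: subgroup1.
  by rewrite -e => -[h Hh <-]; rewrite mulKg.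
apply/seteqP; split=> _ [h Hh <-].
  exists (y^-1 * (x * h)); last by rewrite mulVKg.
  by rewrite mulgA; apply: subgroupM => //; rewrite -[x]invgK -invgM; apply: subgroupV.
exists (x^-1 * (y * h)); last by rewrite mulVKg.
by rewrite mulgA; apply: subgroupM.
Qed.

Lemma finite_indexP {A H} : is_subgroup H -> finite_index A H <-> finite_cover A H.
Proof.
move=> sH; split=> [fAH|[s sP]].
  by apply: finite_cover_of_image fAH _ => x y _ _ /(lcoset_eqP sH).
apply: (sub_finite_set _ (finite_image (fun r => lcoset r H) (finite_seq s))).
move=> _ [x Ax <-]; have [r rs Hrx] := sP x Ax.
by exists r => //; apply/(lcoset_eqP sH).
Qed.

Lemma finite_cover_sub {A A' B B'} : A' `<=` A -> B `<=` B' ->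
  finite_cover A B -> finite_cover A' B'.
Proof.
by move=> AA BB [s sP]; exists s => x /AA/sP[r rs /BB]; exists r.
Qed.

Lemma finite_cover_trans {A B C} :
  finite_cover A B -> finite_cover B C -> finite_cover A C.
Proof.
move=> [s sP] [t tP]; exists [seq a * b | a <- s, b <- t] => x /sP[a sa /tP[b tb Cx]].
by exists (a * b); [apply: allpairs_f | rewrite invgM -mulgA].
Qed.

Lemma finite_cover_finite {A B} : finite_cover A B -> finite_set B -> finite_set A.
Proof.
move=> [s sP] fB.
apply: (sub_finite_set _ (finite_image2 (fun a b => a * b) (finite_seq s) fB)).
by move=> x /sP[r rs Brx]; exists r => //; exists (r^-1 * x); rewrite ?mulVKg.
Qed.

(** Two of the infinitely many powers of [x] lie in the same of finitely many
    left cosets. *)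
Lemma finite_cover_power {K B x} :
  is_subgroup K -> is_subgroup B -> finite_cover K B -> K x ->
  exists2 a : int, a != 0%R & B (x ^^ a).
Proof.
move=> sK sB [s sP] Kx.
have /choice[f fP] (n : nat) : exists r, r \in s /\ B (r^-1 * x ^^ n).
  by have [r rs Br] := sP _ (subgroupX (k := n) sK Kx); exists r.
have [a [b [ab fab]]] : exists a b, a <> b /\ f a = f b.
  apply: contrapT => noab; apply: infinite_nat.
  have -> : [set: nat] = f @^-1` [set` s].
    by apply/seteqP; split=> // n _; apply: (fP n).1.
  apply: finite_preimage (finite_seq s) => a b _ _ fab.
  by apply: contrapT => ab; apply: noab; exists a, b.
exists (b%:Z - a%:Z)%R; first by lia.
have -> : x ^^ (b%:Z - a%:Z)%R = ((f a)^-1 * x ^^ a)^-1 * ((f a)^-1 * x ^^ b).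
  by rewrite addrC zpowD zpowN invgM invgK -mulgA mulVKg.
apply: subgroupM => //; first exact/subgroupV/(fP a).2.
by rewrite fab; apply: (fP b).2.
Qed.

Lemma finite_cycle x : ~ infinite_order x -> finite_set (Defs.cycle x).
Proof.
move=> nx.
have [n n0 xn] : exists2 n : nat, (0 < n)%N & x ^+ n = 1.
  apply: contrapT => non; apply: nx => -[n|n] e.
    by case: n e => // n e; case: non; exists n.+1.
  by case: non; exists n.+1 => //; apply: invg_inj; rewrite invg1.
apply: (sub_finite_set _ (finite_image (fun i => x ^+ i) (finite_II n))).
move=> _ /cycleE[k ->]; exists `|(k %% n)%Z|%N => /=.
  have := ltz_pmod k (d := n); lia.
have {2}-> : k = (n%:Z * (k %/ n)%Z + (k %% n)%Z)%R by lia.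
rewrite zpowD zpowM {2}/zpow xn zpow1g mul1g.
rewrite -[LHS]/(x ^^ `|(k %% n)%Z|%N); congr (_ ^^ _).
by apply: gez0_abs; apply: modz_ge0; lia.
Qed.

Lemma infinite_cycle x : infinite_order x -> infinite_set (Defs.cycle x).
Proof.
move=> ox fx; apply: infinite_nat.
have -> : [set: nat] = (fun n => x ^+ n) @^-1` Defs.cycle x.
  by apply/seteqP; split=> // n _; exists n; left.
apply: finite_preimage fx => a b _ _ e.
suff : (a%:Z - b%:Z = 0)%R by lia.
by apply: ox; rewrite zpowD zpowN /= e mulgV.
Qed.

Lemma infinite_order_of_finite_cover {K d} :
  infinite_set K -> finite_cover K (Defs.cycle d) -> infinite_order d.
Proof.
by move=> iK cK; apply: contrapT => /finite_cycle fd; apply/iK/(finite_cover_finite cK).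
Qed.

Lemma infinite_order_zpow x k : infinite_order x -> k != 0%R -> infinite_order (x ^^ k).
Proof.
by move=> ox k0 j; rewrite -zpowM => /ox /eqP; rewrite mulf_eq0 (negbTE k0) => /eqP.
Qed.

Lemma infinite_orderJ x g : infinite_order x -> infinite_order (x ^ g).
Proof.
by move=> ox k; rewrite -conjg_zpow => /eqP; rewrite conjg_eq1 => /eqP /ox.
Qed.

Lemma zpow_inj x : infinite_order x -> injective (zpow x).
Proof.
move=> ox j k e; suff : (j - k = 0)%R by lia.
by apply: ox; rewrite zpowD zpowN e mulgV.
Qed.

(** * Commensurators *)

(** Leaving the two exponents unrelated makes this an equivalence relation
    compatible with conjugation in every group, so that commensurators are
    subgroups.  Relations such as those of a Baumslag-Solitar group, where
    [c ^ g] and [c] have exponents of different absolute values, are excluded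
    only later, by comparing images of the transfer. *)
Definition commensurable x y :=
  exists m n : int, [/\ m != 0%R, n != 0%R & x ^^ m = y ^^ n].

Lemma commensurable_sym {x y} : commensurable x y -> commensurable y x.
Proof. by case=> m [n [m0 n0 e]]; exists n, m. Qed.

Lemma commensurable_trans {x y z} :
  commensurable x y -> commensurable y z -> commensurable x z.
Proof.
move=> [m [n [m0 n0 e]]] [j [k [j0 k0 f]]]; exists (m * j)%R, (k * n)%R.
by rewrite !mulf_neq0 //; split=> //; rewrite !zpowM e zpowC f.
Qed.

Lemma commensurableJ x y g : commensurable x y -> commensurable (x ^ g) (y ^ g).
Proof. by case=> m [n [m0 n0 e]]; exists m, n; rewrite -!conjg_zpow e. Qed.

(** A power of each element lies in the group of [d], and two nontrivial
    subgroups of an infinite cyclic group meet nontrivially. *)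
Lemma commensurable_in_cover {K d x y} : is_subgroup K -> finite_cover K (Defs.cycle d) ->
  K x -> K y -> infinite_order x -> infinite_order y -> commensurable x y.
Proof.
move=> sK cK; suff to_d z : K z -> infinite_order z -> commensurable z d.
  move=> Kx Ky ox oy.
  exact: commensurable_trans (to_d x Kx ox) (commensurable_sym (to_d y Ky oy)).
move=> Kz oz; have [a a0 /cycleE[k e]] := finite_cover_power sK (cycle_subgroup d) cK Kz.
exists a, k; split=> //; apply: contra_neq a0 => k0.
by apply: oz; rewrite e k0.
Qed.

Definition commensurator c : set G := [set g | commensurable c (c ^ g)].

Lemma commensurator_subgroup c : is_subgroup (commensurator c).
Proof.
apply/is_subgroupP; split=> [|x y Ex Ey] /=; first by exists 1%R, 1%R; rewrite conjg1.
apply: (commensurable_trans (y := c ^ y^-1)).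
  apply: commensurable_sym; rewrite -{2}[c](conjgK y); exact: commensurableJ.
by rewrite conjgM; apply: commensurableJ.
Qed.

Lemma sub_commensurator {K c d} : is_subgroup K -> finite_cover K (Defs.cycle d) ->
  K c -> infinite_order c -> K `<=` commensurator c.
Proof.
move=> sK cK Kc oc k Kk; apply: (commensurable_in_cover sK cK) => //.
  exact: subgroupJ.
exact: infinite_orderJ.
Qed.

(** Finitely many exponents are replaced by their product. *)
Lemma uniform_exponent (P : G -> nat -> Prop) (s : seq G) :
  (forall x m k, P x m -> P x (k * m)%N) ->
  (forall r, r \in s -> exists2 m, (0 < m)%N & P r m) ->
  exists2 M, (0 < M)%N & forall r, r \in s -> P r M.
Proof.
move=> PM; elim: s => [|x s IH] sP; first by exists 1%N.
have [m m0 Pm] := sP x (mem_head _ _).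
have [|n n0 Pn] := IH; first by move=> r rs; apply: sP; rewrite inE rs orbT.
exists (m * n)%N; rewrite ?muln_gt0 ?m0 // => r.
rewrite inE => /orP[/eqP->|/Pn]; last exact: PM.
by rewrite mulnC; apply: PM.
Qed.

End FiniteCovers.

(** * The transfer to a central infinite cyclic subgroup *)

Section Transfer.
Context {G : groupType}.
Implicit Types (x y z w d : G) (Z : set G).

Definition additive_on Z (phi : G -> int) :=
  forall x y, Z x -> Z y -> phi (x * y) = (phi x + phi y)%R.

Lemma additive1 {Z phi} : is_subgroup Z -> additive_on Z phi -> phi 1 = 0%R.
Proof.
by move=> sZ aP; have := aP 1 1 (subgroup1 sZ) (subgroup1 sZ); rewrite mulg1; lia.
Qed.

Lemma additiveV {Z phi x} : is_subgroup Z -> additive_on Z phi -> Z x ->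
  phi x^-1 = (- phi x)%R.
Proof.
move=> sZ aP Zx; have := aP x x^-1 Zx (subgroupV sZ Zx).
by rewrite mulgV (additive1 sZ aP); lia.
Qed.

Lemma additiveX {Z phi x} k : is_subgroup Z -> additive_on Z phi -> Z x ->
  phi (x ^^ k) = (k * phi x)%R.
Proof.
move=> sZ aP Zx; have natX n : phi (x ^^ Posz n) = (n%:Z * phi x)%R.
  elim: n => [|n IH]; first by rewrite mul0r (additive1 sZ aP).
  have -> : (n.+1%:Z = n%:Z + 1)%R by lia.
  by rewrite zpowS aP ?IH ?mulrDl ?mul1r //; apply: subgroupX.
case: k => n; first exact: natX.
have -> : Negz n = (- n.+1%:Z)%R by lia.
by rewrite zpowN (additiveV sZ aP) ?natX ?mulNr //; apply: subgroupX.
Qed.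

(** The transfer. With [rep x] a representative of the coset of [x] and
    [x = rep x * d ^^ e x], the function [e] is a cocycle,
    [e (x * z * w) = e (x * z) + e (rep (x * z) * w)],
    since [d] is central.  Summing over the representatives [x] gives a
    homomorphism because right multiplication by [z] permutes the cosets; its
    value at [d] is the index. *)
Lemma transfer {Z d} : is_subgroup Z -> Z d -> infinite_order d ->
  (forall z, Z z -> commute z d) -> finite_cover Z (Defs.cycle d) ->
  exists phi : G -> int, additive_on Z phi /\ phi d != 0%R.
Proof.
move=> sZ Zd od cZd cov; pose D := Defs.cycle d.
have sD : is_subgroup D := cycle_subgroup d.
pose rep x := xget 1 (lcoset x D).
have repP x : D ((rep x)^-1 * x).
  have : lcoset x D (rep x).
    have : lcoset x D !=set0 by exists x; exists 1; [apply: subgroup1 | rewrite mulg1].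
    exact: xgetPex.
  by case=> h Dh <-; rewrite invgM -mulgA mulVg mulg1; apply: subgroupV.
have rep_eq x y : D (x^-1 * y) -> rep x = rep y.
  by move=> Dxy; rewrite /rep; congr xget; apply/(lcoset_eqP sD).
have rep_inj x y : rep x = rep y -> D (x^-1 * y).
  move=> exy; have -> : x^-1 * y = ((rep x)^-1 * x)^-1 * ((rep y)^-1 * y).
    by rewrite invgM invgK exy -mulgA mulVKg.
  by apply: subgroupM => //; apply: subgroupV.
have /choice[e eP] x : exists k : int, x = rep x * d ^^ k.
  by have /cycleE[k ek] := repP x; exists k; rewrite -ek mulVKg.
have eM x k : Z x -> e (x * d ^^ k) = (e x + k)%R.
  move=> Zx; apply: (zpow_inj _ od); apply: (mulgI (rep (x * d ^^ k))).
  rewrite -eP zpowD mulgA; congr (_ * _).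
  rewrite {1}(eP x); congr (_ * _); apply: rep_eq; rewrite mulKg.
  by apply/cycleE; exists k.
have Zrep x : Z x -> Z (rep x).
  move=> Zx; have -> : rep x = x * ((rep x)^-1 * x)^-1 by rewrite invgM invgK mulVKg.
  by apply: subgroupM => //; apply: subgroupV => //; apply: cycle_sub (repP x).
have [s [sZr sP]] := finite_cover_reps sD cov.
pose cs := undup [seq rep r | r <- s].
have csP r : r \in cs <-> exists2 x, Z x & r = rep x.
  rewrite mem_undup; split=> [/mapP[x xs ->]|[x Zx ->]].
    by exists x => //; apply: sZr.
  by have [r0 rs Dr] := sP x Zx; rewrite -(rep_eq _ _ Dr); apply: map_f.
have csZ r : r \in cs -> Z r by case/csP=> x Zx ->; apply: Zrep.
have rep_id x : rep (rep x) = rep x by apply: rep_eq.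
pose phi z := (\sum_(r <- cs) e (r * z)%g)%R.
exists phi; split=> [z w Zz Zw|].
- have perm_cs : perm_eq cs [seq rep (r * z) | r <- cs].
    have u : uniq [seq rep (r * z) | r <- cs].
      rewrite map_inj_in_uniq ?undup_uniq // => _ _ /csP[r Zr ->] /csP[t Zt ->] /rep_inj.
      rewrite invgM -mulgA (mulgA (rep r)^-1) => Drt.
      rewrite -(rep_id r) -(rep_id t); apply: rep_eq.
      have /cycleE[k ek] : D (((rep r)^-1 * rep t) ^ z).
        by rewrite conjgE -!mulgA in Drt *.
      have /commute_conjg czd := commute_zpow _ _ k (cZd _ (subgroupV sZ Zz)).
      by apply/cycleE; exists k; rewrite -czd -ek conjgK.
    rewrite perm_sym; apply: uniq_perm (undup_uniq _) _ => //.
    have sub : {subset [seq rep (r * z) | r <- cs] <= cs}.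
      by move=> _ /mapP[r /csZ Zr ->]; apply/csP; exists (r * z) => //; apply: subgroupM.
    by have [] := uniq_min_size u sub; rewrite ?size_map.
  have -> : phi w = (\sum_(r <- cs) e (rep (r * z) * w)%g)%R.
    by rewrite /phi (perm_big _ perm_cs) big_map.
  rewrite addrC -big_split /= /phi !big_seq; apply: eq_bigr => r /csZ Zr.
  have Zrz : Z (r * z) by apply: subgroupM.
  rewrite -eM; last by apply: subgroupM => //; apply: Zrep.
  have -> : rep (r * z) * w * d ^^ e (r * z) = rep (r * z) * d ^^ e (r * z) * w.
    by rewrite -!mulgA (commute_zpow _ _ _ (cZd _ Zw)).
  by rewrite -eP mulgA.
- have -> : phi d = Posz (size cs).
    rewrite /phi big_seq (eq_bigr (fun=> 1%R)) => [|r rcs].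
      by rewrite -big_seq big_const_seq count_predT iter_addr_0 -mulr_natr mul1r natz.
    have Zr := csZ r rcs; have e0 : e r = 0%R.
      apply: od; apply: (mulgI r); rewrite mulg1 [RHS]eP.
      by case/csP: rcs => x _ ->; rewrite rep_id.
    by rewrite (eM r 1%R Zr) e0.
  have : rep 1 \in cs by apply/csP; exists 1; first exact: subgroup1.
  by case: (cs).
Qed.

End Transfer.

(** * Torsion elements and conjugation *)

Section Degree.
Context {G : groupType}.
Implicit Types (x z g c d : G) (Z : set G).

Definition torsion x := exists2 a : int, a != 0%R & x ^^ a = 1.

(** Some nonzero power of [z] is [d ^^ k], and [phi] vanishes on [z] if and
    only if [k = 0]. *)
Lemma torsion_kernel {Z d phi} : is_subgroup Z -> Z d -> infinite_order d ->
  finite_cover Z (Defs.cycle d) -> additive_on Z phi -> phi d != 0%R ->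
  forall z, Z z -> torsion z <-> phi z = 0%R.
Proof.
move=> sZ Zd od cov aP phid z Zz; split=> [[a a0 za]|phiz].
  have := additiveX a sZ aP Zz; rewrite za (additive1 sZ aP) => /esym/eqP.
  by rewrite mulf_eq0 (negbTE a0) => /eqP.
have [a a0 /cycleE[k e]] := finite_cover_power sZ (cycle_subgroup d) cov Zz.
have : (k * phi d = 0)%R.
  by rewrite -(additiveX k sZ aP Zd) -e (additiveX a sZ aP Zz) phiz mulr0.
by move/eqP; rewrite mulf_eq0 (negbTE phid) orbF => /eqP k0; exists a; rewrite // e k0.
Qed.

(** The kernel meets the group of [d] trivially, so it has at most one element
    in each coset. *)
Lemma finite_kernel {Z d phi} : is_subgroup Z -> Z d ->
  finite_cover Z (Defs.cycle d) -> additive_on Z phi -> phi d != 0%R ->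
  finite_set [set z | Z z /\ phi z = 0%R].
Proof.
move=> sZ Zd cov aP phid.
have covK : finite_cover [set z | Z z /\ phi z = 0%R] (Defs.cycle d).
  by apply: finite_cover_sub cov => // z [].
have [s [sK sP]] := finite_cover_reps (cycle_subgroup d) covK.
apply: (sub_finite_set _ (finite_seq s)) => z Kz /=.
have [r rs /cycleE[k e]] := sP z Kz; have [Zr phir] := sK r rs; have [Zz phiz] := Kz.
have := additiveX k sZ aP Zd.
rewrite -e (aP _ _ (subgroupV sZ Zr) Zz) (additiveV sZ aP Zr) phir phiz => /esym/eqP.
rewrite addr0 oppr0 mulf_eq0 (negbTE phid) orbF => /eqP k0.
by rewrite -(mulVKg r z) e k0 mulg1.
Qed.

(** Every element of [Z] has a nonzero power in the group of [c], so the
    homomorphisms [phi] and [z |-> phi (z ^ g)] are proportional, with ratio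
    [phi (c ^ g) / phi c = n / m].  They have the same image, as
    [Z ^ g = Z], and the least positive absolute value taken in the image shows
    that the ratio is [1] or [-1]. *)
Lemma conj_exponents {Z c g phi} {m n : int} : is_subgroup Z ->
  (forall x, Z x <-> Z (x ^ g)) ->
  additive_on Z phi -> Z c -> phi c != 0%R ->
  (forall z, Z z -> exists a b : int, a != 0%R /\ z ^^ a = c ^^ b) ->
  m != 0%R -> n != 0%R -> (c ^^ m) ^ g = c ^^ n -> `|m|%N = `|n|%N.
Proof.
move=> sZ Zg aP Zc q0 zP m0 n0 e.
have Zcg : Z (c ^ g) := (Zg c).1 Zc.
have pq : (m * phi (c ^ g)%g = n * phi c)%R.
  by rewrite -(additiveX m sZ aP Zcg) -(additiveX n sZ aP Zc) -conjg_zpow e.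
have p0 : phi (c ^ g) != 0%R.
  by apply: contra_neq (mulf_neq0 n0 q0) => p0; rewrite -pq p0 mulr0.
have prop z : Z z -> (phi (z ^ g)%g * phi c = phi (c ^ g)%g * phi z)%R.
  move=> Zz; have [a [b [a0 zab]]] := zP z Zz.
  have Zzg : Z (z ^ g) := (Zg z).1 Zz.
  have e1 : (a * phi z = b * phi c)%R.
    by rewrite -(additiveX a sZ aP Zz) -(additiveX b sZ aP Zc) zab.
  have e2 : (a * phi (z ^ g)%g = b * phi (c ^ g)%g)%R.
    by rewrite -(additiveX a sZ aP Zzg) -(additiveX b sZ aP Zcg) -!conjg_zpow zab.
  apply: (mulfI a0); rewrite mulrA e2 mulrCA e1; lia.
pose P k := (0 < k)%N && `[< exists2 z, Z z & `|phi z|%N = k >].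
have exP : exists k, P k.
  by exists `|phi c|%N; rewrite /P absz_gt0 q0; apply/asboolP; exists c.
have [z [Zz z0 zmin]] : exists z, [/\ Z z, phi z != 0%R &
    forall w, Z w -> phi w != 0%R -> (`|phi z| <= `|phi w|)%N].
  case: (ex_minnP exP) => k /andP[k0 /asboolP[z Zz zk]] kmin.
  exists z; split=> //; first by rewrite -absz_gt0 zk.
  move=> w Zw w0; rewrite zk; apply: kmin.
  by rewrite /P absz_gt0 w0; apply/asboolP; exists w.
(* Minimality is used against the two conjugates of [z], by [g] and by its
   inverse: each bounds one of [phi c] and [phi (c ^ g)] by the other. *)
have Zzg : Z (z ^ g) := (Zg z).1 Zz.
have Zw : Z (z ^ g^-1) by apply: (Zg _).2; rewrite conjgKV.
have ez := prop z Zz; have ew := prop _ Zw; rewrite conjgKV in ew.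
have zg0 : phi (z ^ g) != 0%R.
  by apply: contra_neq (mulf_neq0 p0 z0) => zg0; rewrite -ez zg0 mul0r.
have w0 : phi (z ^ g^-1) != 0%R.
  by apply: contra_neq (mulf_neq0 z0 q0) => w0; rewrite ew w0 mulr0.
have le1 := zmin _ Zzg zg0; have le2 := zmin _ Zw w0.
move/(congr1 absz): ez; move/(congr1 absz): ew; move/(congr1 absz): pq.
rewrite !abszM => pq ew ez.
have qp : `|phi c|%N = `|phi (c ^ g)%g|%N.
  apply/eqP; rewrite eqn_leq; apply/andP; split.
    rewrite -(leq_pmul2r (m := `|phi z|%N)) ?absz_gt0 // -ez mulnC.
    by rewrite leq_mul2r le1 orbT.
  rewrite -(leq_pmul2r (m := `|phi z|%N)) ?absz_gt0 // (mulnC `|phi c|%N) ew.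
  by rewrite leq_mul2l le2 orbT.
apply/eqP; rewrite -(eqn_pmul2r (m := `|phi c|%N)) ?absz_gt0 //.
by rewrite {1}qp pq.
Qed.

End Degree.

(** * The commensurator is virtually cyclic *)

Section Commensurator.
Context {G : groupType}.
Implicit Types (x z g c : G) (K V : set G).

Hypothesis finite_index_centralizer : forall C : set G,
  infinite_cyclic C -> finite_index (centralizer C) C.
Hypothesis finite_chains_stationary : forall H : nat -> set G,
  (forall n, is_subgroup (H n) /\ finite_set (H n)) ->
  (forall n, H n `<=` H n.+1) ->
  exists n0 : nat, forall n : nat, (n0 <= n)%N -> H n = H n0.

Definition power_centralizer (m : nat) c : set G := [set z | commute z (c ^+ m)].

Definition virtual_centralizer c : set G :=
  [set z | exists2 m : nat, (0 < m)%N & commute z (c ^+ m)].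

Lemma infinite_orderX c m : infinite_order c -> (0 < m)%N -> infinite_order (c ^+ m).
Proof.
by move=> oc m0; apply: (infinite_order_zpow c (Posz m) oc); rewrite eqz_nat -lt0n.
Qed.

Lemma power_centralizerE m c :
  power_centralizer m c = centralizer (Defs.cycle (c ^+ m)).
Proof. by rewrite centralizer_cycle. Qed.

Lemma power_centralizer_subgroup m c : is_subgroup (power_centralizer m c).
Proof. rewrite power_centralizerE; exact: centralizer_subgroup. Qed.

Lemma power_centralizer_sub m k c :
  power_centralizer m c `<=` power_centralizer (m * k)%N c.
Proof. by move=> z cz; rewrite /power_centralizer /= expgnA; apply: commuteX. Qed.

Lemma power_centralizer_id m c : power_centralizer m c c.
Proof. exact/commuteX/commute_refl. Qed.

Lemma power_centralizer_X m c : power_centralizer m c (c ^+ m).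
Proof. by rewrite /power_centralizer /=. Qed.

Lemma virtual_centralizer_subgroup c : is_subgroup (virtual_centralizer c).
Proof.
apply/is_subgroupP; split=> [|x y [m m0 cx] [n n0 cy]].
  by exists 1%N => //; apply/commute_sym/commute1.
exists (m * n)%N; first by rewrite muln_gt0 m0.
have [_] := (is_subgroupP _).1 (power_centralizer_subgroup (m * n)%N c).
apply; first exact: power_centralizer_sub.
by rewrite mulnC; apply: power_centralizer_sub.
Qed.

Lemma finite_cover_power_centralizer c m : infinite_order c -> (0 < m)%N ->
  finite_cover (power_centralizer m c) (Defs.cycle (c ^+ m)).
Proof.
move=> oc m0; rewrite power_centralizerE; apply/(finite_indexP (cycle_subgroup _)).
apply: finite_index_centralizer; split; first by exists (c ^+ m).
exact/infinite_cycle/infinite_orderX.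
Qed.

Lemma power_centralizer_degree c m : infinite_order c -> (0 < m)%N ->
  exists phi : G -> int,
    additive_on (power_centralizer m c) phi /\ phi (c ^+ m) != 0%R.
Proof.
move=> oc m0; apply: transfer (finite_cover_power_centralizer _ _ oc m0) => //.
- exact: power_centralizer_subgroup.
- exact: infinite_orderX.
Qed.

Lemma torsion_power_centralizer c m : infinite_order c -> (0 < m)%N ->
  let T := [set z | power_centralizer m c z /\ torsion z] in
  is_subgroup T /\ finite_set T.
Proof.
move=> oc m0; have [phi [aP phic]] := power_centralizer_degree _ _ oc m0.
have sC := power_centralizer_subgroup m c.
have cov := finite_cover_power_centralizer _ _ oc m0.
have Ccm : power_centralizer m c (c ^+ m) by apply: power_centralizer_X.
have tP := torsion_kernel sC Ccm (infinite_orderX _ _ oc m0) cov aP phic.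
have TE : [set z | power_centralizer m c z /\ torsion z] =
          [set z | power_centralizer m c z /\ phi z = 0%R].
  by apply/seteqP; split=> z [Cz /(tP z Cz)].
rewrite TE; split; last exact: finite_kernel sC Ccm cov aP phic.
apply/is_subgroupP; split=> [|x y [Cx x0] [Cy y0]].
  by split; [apply: subgroup1 | apply: additive1 sC aP].
split; first by case/is_subgroupP: sC => _; apply.
by rewrite aP //; [rewrite (additiveV sC aP Cy) x0 y0 | apply: subgroupV].
Qed.

(** The centralizers of [c ^+ n`!] form a chain with union
    [virtual_centralizer c], and their torsion elements form a chain of finite
    subgroups. *)
Lemma finite_torsion_virtual_centralizer c : infinite_order c ->
  finite_set [set z | virtual_centralizer c z /\ torsion z].
Proof.
move=> oc; pose T n := [set z | power_centralizer n`! c z /\ torsion z].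
have TP n : is_subgroup (T n) /\ finite_set (T n).
  exact: torsion_power_centralizer oc (fact_gt0 n).
have TS n : T n `<=` T n.+1.
  by move=> z [Cz tz]; split=> //; rewrite factS mulnC; apply: power_centralizer_sub.
have [n0 Tn0] := finite_chains_stationary T TP TS.
apply: (sub_finite_set _ (TP n0).2) => z [[m m0 Cz] tz].
(* The factorial of [m + n0] is a multiple of [m] and lies in the stationary
   range. *)
rewrite -(Tn0 (m + n0)%N (leq_addl _ _)); split=> //.
have /dvdnP[k ->] : (m %| (m + n0)`!)%N by apply: dvdn_fact; rewrite m0 leq_addr.
by rewrite mulnC; apply: power_centralizer_sub.
Qed.

(** If [z] commutes with [c ^+ m], then [c ^ z^-1 * c^-1] is a commutator in
    the centralizer of [c ^+ m], hence torsion.  So [c] has finitely many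
    conjugates under [virtual_centralizer c], and elements that give the same
    conjugate differ by an element of the centralizer of [c]. *)
Lemma finite_cover_virtual_centralizer c : infinite_order c ->
  finite_cover (virtual_centralizer c) (power_centralizer 1 c).
Proof.
move=> oc; apply: (finite_cover_of_image (fun z => c ^ z^-1)).
  apply: (sub_finite_set _ (finite_image (fun t => t * c)
           (finite_torsion_virtual_centralizer _ oc))).
  move=> _ [z [m m0 Cz] <-]; exists (c ^ z^-1 * c^-1); last by rewrite mulgVK.
  have sC := power_centralizer_subgroup m c.
  have Cc := power_centralizer_id m c.
  have Czc : power_centralizer m c (c ^ z^-1).
    by apply: subgroupJ => //; apply: subgroupV.
  have Cu : power_centralizer m c (c ^ z^-1 * c^-1).
    by apply: subgroupM => //; apply: subgroupV.
  split; first by exists m.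
  have [phi [aP phic]] := power_centralizer_degree _ _ oc m0.
  apply/(torsion_kernel sC _ (infinite_orderX _ _ oc m0)
           (finite_cover_power_centralizer _ _ oc m0) aP phic) => //.
  have CV := subgroupV sC Cc; have CVz := subgroupV sC Cz.
  rewrite aP // (additiveV sC aP Cc) conjgE invgK.
  rewrite aP //; last exact: subgroupM.
  by rewrite aP // (additiveV sC aP Cz); lia.
move=> x y _ _ exy; apply/commute_sym/commute_conjg.
suff : c ^ (x^-1 * y) = c by move/commute_conjg/commute_sym/commute_conjg.
by rewrite conjgM exy conjgKV.
Qed.

Lemma virtual_centralizer_stable c : infinite_order c ->
  exists2 M, (0 < M)%N & virtual_centralizer c = power_centralizer M c.
Proof.
move=> oc; have [s [sZ sP]] := finite_cover_reps (power_centralizer_subgroup 1 c)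
  (finite_cover_virtual_centralizer _ oc).
have [||M M0 MP] := uniform_exponent (fun z m => power_centralizer m c z) s.
- by move=> z m k; rewrite mulnC; apply: power_centralizer_sub.
- exact: sZ.
exists M => //; apply/seteqP; split=> z; last by exists M.
move=> /sP[r rs Cr]; rewrite -(mulVKg r z); apply: subgroupM.
- exact: power_centralizer_subgroup.
- exact: MP.
- by rewrite -[M]mul1n; apply: power_centralizer_sub.
Qed.

Lemma finite_cover_virtual_centralizer_cycle c : infinite_order c ->
  finite_cover (virtual_centralizer c) (Defs.cycle c).
Proof.
move=> oc; apply: finite_cover_trans (finite_cover_virtual_centralizer _ oc) _.
exact: finite_cover_power_centralizer.
Qed.

Lemma virtual_centralizer_id c : virtual_centralizer c c.
Proof. by exists 1%N => //; apply: power_centralizer_id. Qed.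

Lemma virtual_centralizer_zpow c z (k : int) :
  k != 0%R -> commute z (c ^^ k) -> virtual_centralizer c z.
Proof.
case: k => n k0 cz; first by exists n; rewrite // lt0n.
by exists n.+1 => //; rewrite -[c ^+ _]invgK; apply: commuteV.
Qed.

Lemma virtual_centralizerJ c g z : commensurator c g ->
  virtual_centralizer c z -> virtual_centralizer c (z ^ g).
Proof.
move=> [m [n [m0 n0 e]]] [k k0 cz].
apply: (virtual_centralizer_zpow _ _ (m * k%:Z)%R).
  by rewrite mulf_neq0 // eqz_nat -lt0n.
rewrite zpowM e zpowC -conjg_zpow; apply: commute_zpow.
by move/commute_conjg: cz => /(congr1 (conjg^~ g)); rewrite conjJg => /commute_conjg.
Qed.

(** The subgroup [virtual_centralizer c] is stable under conjugation by [g] and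
    carries a transfer, as it is the centralizer of a power of [c]; so the
    exponents in a relation between [c] and [c ^ g] agree up to sign. *)
Lemma commensurator_sign c g : infinite_order c -> commensurator c g ->
  exists2 k, (0 < k)%N & (c ^+ k) ^ g = c ^+ k \/ (c ^+ k) ^ g = c ^- k.
Proof.
move=> oc Eg; have [m [n [m0 n0 e]]] := Eg.
have [M M0 ZE] := virtual_centralizer_stable _ oc.
have sZ := virtual_centralizer_subgroup c; have Zc := virtual_centralizer_id c.
have [phi [aP phic]] := power_centralizer_degree _ _ oc M0; rewrite -ZE in aP.
have q0 : phi c != 0%R.
  apply: contra_neq phic => q0.
  by rewrite -[c ^+ M]/(c ^^ M) (additiveX M sZ aP Zc) q0 mulr0.
have Zg x : virtual_centralizer c x <-> virtual_centralizer c (x ^ g).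
  split=> [|Zxg]; first exact: virtual_centralizerJ.
  rewrite -(conjgK g x); apply: virtual_centralizerJ => //.
  exact: subgroupV (commensurator_subgroup c) Eg.
have zP z : virtual_centralizer c z -> exists a b : int, a != 0%R /\ z ^^ a = c ^^ b.
  move=> Zz; have [a a0 /cycleE[b ab]] := finite_cover_power sZ (cycle_subgroup c)
    (finite_cover_virtual_centralizer_cycle _ oc) Zz.
  by exists a, b.
have := conj_exponents (m := n) (n := m) sZ Zg aP Zc q0 zP n0 m0.
rewrite conjg_zpow e => /(_ erefl) nm.
rewrite -conjg_zpow in e.
have [k [k0 en em]] : exists k : nat,
    [/\ (0 < k)%N, n = Posz k \/ n = (- k%:Z)%R & m = Posz k \/ m = (- k%:Z)%R].
  by exists `|n|%N; split; lia.
exists k => //; case: en em e => -> [] -> /=; rewrite ?zpowN ?conjVg /= => /esym e.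
- by left.
- by right.
- by right; apply: invg_inj; rewrite invgK.
- by left; apply: invg_inj.
Qed.

Lemma commensurator_sign_mul c g m k :
  (c ^+ m) ^ g = c ^+ m \/ (c ^+ m) ^ g = c ^- m ->
  (c ^+ (m * k)) ^ g = c ^+ (m * k) \/ (c ^+ (m * k)) ^ g = c ^- (m * k).
Proof.
move=> e; rewrite !expgnA (conjXg (c ^+ m)).
by case: e => ->; [left | right; rewrite expVgn].
Qed.

(** Two elements that invert powers of [c] differ by an element that
    centralizes a power of [c]: the index of [virtual_centralizer c] is at most
    two. *)
Lemma finite_cover_commensurator c : infinite_order c ->
  finite_cover (commensurator c) (Defs.cycle c).
Proof.
move=> oc; apply: finite_cover_trans (finite_cover_virtual_centralizer_cycle _ oc).
apply: (finite_cover_of_image (fun g => `[< virtual_centralizer c g >])).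
  exact: sub_finite_set (subsetT _) (finite_finset (X := setT)).
have sZ := virtual_centralizer_subgroup c.
move=> x y Ex Ey; have [Zx|nZx] := pselect (virtual_centralizer c x).
  rewrite (asboolT Zx) => /esym/asboolP Zy.
  by apply: subgroupM => //; apply: subgroupV.
rewrite (asboolF nZx) => /esym/asboolPn nZy.
have inv z : commensurator c z -> ~ virtual_centralizer c z ->
    exists2 k, (0 < k)%N & (c ^+ k) ^ z = c ^- k.
  move=> Ez nZz; have [k k0 [ez|ez]] := commensurator_sign _ _ oc Ez.
    by case: nZz; exists k => //; apply/commute_conjg.
  by exists k.
have [k k0 ek] := inv x Ex nZx; have [l l0 el] := inv y Ey nZy.
exists (k * l)%N; first by rewrite muln_gt0 k0.
have ekl : (c ^+ (k * l)) ^ x = c ^- (k * l).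
  by rewrite expgnA (conjXg (c ^+ k)) ek expVgn.
have elk : (c ^+ (k * l)) ^ y = c ^- (k * l).
  by rewrite mulnC expgnA (conjXg (c ^+ l)) el expVgn.
apply/commute_conjg; rewrite conjgM.
have -> : (c ^+ (k * l)) ^ x^-1 = c ^- (k * l).
  by apply: (conjg_inj x); rewrite conjgKV conjVg ekl invgK.
by rewrite conjVg elk invgK.
Qed.

(** Elements of the group of [c] centralize all powers of [c], so only the
    finitely many coset representatives constrain [M]. *)
Lemma commensurator_uniform c : infinite_order c ->
  exists2 M, (0 < M)%N & forall g, commensurator c g ->
    (c ^+ M) ^ g = c ^+ M \/ (c ^+ M) ^ g = c ^- M.
Proof.
move=> oc; have [s [sE sP]] :=
  finite_cover_reps (cycle_subgroup c) (finite_cover_commensurator _ oc).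
have [||M M0 MP] := uniform_exponent
    (fun g m => (c ^+ m) ^ g = c ^+ m \/ (c ^+ m) ^ g = c ^- m) s.
- by move=> g m k; rewrite mulnC; apply: commensurator_sign_mul.
- by move=> r /sE; apply: commensurator_sign.
exists M => // g /sP[r /MP rM /cycleE[k e]].
have fix_c : c ^+ M ^ (c ^^ k) = c ^+ M.
  by apply/commute_conjg/commuteX/commute_sym/commute_zpow/commute_refl.
rewrite -(mulVKg r g) e conjgM.
by case: rM => ->; rewrite ?conjVg fix_c; [left|right].
Qed.

Lemma commensurator_vc c : infinite_order c ->
  infinite_virtually_cyclic (commensurator c).
Proof.
move=> oc; have sE := commensurator_subgroup c.
have Ec : commensurator c c by exists 1%R, 1%R; rewrite conjgE mulKg.
have cE : Defs.cycle c `<=` commensurator c := cycle_sub sE Ec.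
split; last by apply: sub_infinite_set cE (infinite_cycle c oc).
split=> //; exists (Defs.cycle c); split=> //; first by exists c.
exact/(finite_indexP (cycle_subgroup c))/finite_cover_commensurator.
Qed.

Lemma sub_commensurator_of_vc c K : infinite_order c -> virtually_cyclic K -> K c ->
  K `<=` commensurator c.
Proof.
move=> oc [sK [_ [[d ->] _ /(finite_indexP (cycle_subgroup d)) cov]]] Kc.
exact: sub_commensurator sK cov Kc oc.
Qed.

Lemma commensurator_maximal c : infinite_order c ->
  maximal_among virtually_cyclic (commensurator c).
Proof.
move=> oc; split; first exact: (commensurator_vc c oc).1.
move=> K vK EK; apply/seteqP; split=> //; apply: sub_commensurator_of_vc => //.
by apply: EK; exists 1%R, 1%R; rewrite conjgE mulKg.
Qed.

(** If [g] normalizes [commensurator c], then [c] and [c ^ g] are both elements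
    of infinite order of this virtually cyclic group. *)
Lemma commensurator_normalizer c : infinite_order c ->
  normalizer (commensurator c) = commensurator c.
Proof.
move=> oc; have sE := commensurator_subgroup c.
apply/seteqP; split; last exact: sub_normalizer.
move=> g /(normalizerP _ _ sE) Ng.
have Ec : commensurator c c by exists 1%R, 1%R; rewrite conjgE mulKg.
have cov := finite_cover_commensurator _ oc.
apply: (commensurable_in_cover sE cov Ec _ oc (infinite_orderJ c g oc)).
exact: (Ng c).1.
Qed.

(** One inclusion comes from the single normalizer of the group of [c ^+ M],
    with [M] the uniform exponent; the other holds because the generator [x] of
    an infinite cyclic subgroup of [V] is commensurable with [c], and a [g]
    that normalizes this subgroup makes [x ^ g] a power of [x]. *)
Lemma commensurator_bigcup c V : infinite_order c -> virtually_cyclic V -> V c ->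
  commensurator c = \bigcup_(C in [set C : set G |
    infinite_cyclic C /\ normal_in C V]) normalizer C.
Proof.
move=> oc vV Vc; have [sV [_ [[d ->] _ /(finite_indexP (cycle_subgroup d)) cov]]] := vV.
have VE := sub_commensurator sV cov Vc oc.
apply/seteqP; split=> [g Eg|g [_ [[[x ->] inf_x] [xV _]] Ng]].
  have [M M0 MP] := commensurator_uniform _ oc.
  have sM := cycle_subgroup (c ^+ M).
  have NM h : commensurator c h -> normalizer (Defs.cycle (c ^+ M)) h.
    have stab k : commensurator c k ->
        forall x, Defs.cycle (c ^+ M) x -> Defs.cycle (c ^+ M) (x ^ k).
      move=> Ek _ /cycleE[j ->]; rewrite conjg_zpow; apply: subgroupX => //.
      case: (MP k Ek) => ->; first exact: cycle_id.
      by apply: subgroupV => //; apply: cycle_id.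
    move=> Eh; apply/normalizerP => // x; split=> [|Cxh]; first exact: stab.
    rewrite -(conjgK h x); apply: stab => //.
    exact: subgroupV (commensurator_subgroup c) Eh.
  exists (Defs.cycle (c ^+ M)); last exact: NM.
  split.
    by split; [exists (c ^+ M) | apply: infinite_cycle; apply: infinite_orderX].
  split; last by move=> v /VE /NM.
  by apply: cycle_sub => //; apply: (subgroupX (k := Posz M)).
have ox : infinite_order x by apply: contrapT => /finite_cycle.
have cx : commensurable c x.
  by apply: (commensurable_in_cover sV cov Vc _ oc ox); apply: xV; apply: cycle_id.
apply: (commensurable_trans cx).
apply: (commensurable_trans _ (commensurable_sym (commensurableJ _ _ g cx))).
have /(normalizerP _ _ (cycle_subgroup x)) Nx := Ng.
have /cycleE[k ek] := (Nx x).1 (cycle_id x).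
exists k, 1%R; split=> //; apply: contra_neq (oner_neq0 int) => k0.
by apply: (infinite_orderJ x g ox); rewrite ek k0.
Qed.

End Commensurator.

Theorem theorem3p1 (G : groupType)
  (finite_index_centralizer : forall C : set G,
     infinite_cyclic C -> finite_index (centralizer C) C)
  (finite_chains_stationary : forall H : nat -> set G,
     (forall n, is_subgroup (H n) /\ finite_set (H n)) ->
     (forall n, H n `<=` H n.+1) ->
     exists n0 : nat, forall n : nat, (n0 <= n)%N -> H n = H n0) :
  (forall V : set G, infinite_virtually_cyclic V ->
     exists Vmax : set G,
       [/\ unique
             (fun M : set G => maximal_among virtually_cyclic M /\ V `<=` M)
             Vmax,
           Vmax = normalizer Vmax &
           Vmax = \bigcup_(C in [set C : set G |
                                 infinite_cyclic C /\ normal_in C V])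
                    normalizer C])
  /\ NM_FIN_VCY G.
Proof.
have fic := finite_index_centralizer; have fcs := finite_chains_stationary.
have pick (V : set G) : infinite_virtually_cyclic V -> exists2 c, infinite_order c & V c.
  move=> [[sV [_ [[c ->] cV /(finite_indexP (cycle_subgroup c)) cov]]] infV].
  by exists c; [apply: infinite_order_of_finite_cover infV cov | apply/cV/cycle_id].
split=> [V iV|].
  have [c oc Vc] := pick V iV; have VE := sub_commensurator_of_vc c V oc iV.1 Vc.
  exists (commensurator c); split.
  - split=> [|M [[vM maxM] VM]]; first by split=> //; apply: commensurator_maximal.
    apply: maxM; first exact: (commensurator_vc fic fcs c oc).1.
    exact: sub_commensurator_of_vc vM (VM c Vc).
  - by rewrite commensurator_normalizer.
  - exact: commensurator_bigcup oc iV.1 Vc.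
split=> [V iV|M [iM maxM]].
  have [c oc Vc] := pick V iV; have VE := sub_commensurator_of_vc c V oc iV.1 Vc.
  have iE := commensurator_vc fic fcs c oc.
  exists (commensurator c); split.
    split=> //; split=> // K [vK _] EK.
    exact: (commensurator_maximal fic fcs c oc).2.
  move=> M [[iM maxM] VM]; apply: maxM => //.
  exact: sub_commensurator_of_vc iM.1 (VM c Vc).
have [c oc Mc] := pick M iM.
have <- : commensurator c = M.
  apply: maxM; first exact: commensurator_vc.
  exact: sub_commensurator_of_vc oc iM.1 Mc.
exact: commensurator_normalizer.
Qed.
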